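(* Let $n\ge 2$, let $G$ be a $2$-transitive group of permutations of $X=\{1,\dots,n\}$, and let $\gamma:G\to GL(V)$ be a doubly transitive linear representation of $(G,X)$ on a finite-dimensional (real) Euclidean vector space $V$. Then there exists a group homomorphism $\mathcal{J}:G\to G\ltimes\Pi^n$ of the form $\mathcal{J}(\sigma)=(\sigma,\nu^\sigma)$ such that, denoting by $\rho:G\to GL(E)$ the representation associated with $\mathcal{J}$ (on a Euclidean space $E$ with orthonormal basis $(e_1,\dots,e_n)$, given by $\rho_\sigma(e_j)=\nu^\sigma_j e_{\sigma(j)}$ for all $\sigma\in G$, $j\in X$): 1. If $\dim V=n$, then $\gamma$ is isomorphic to $\rho$. 2. If $\dim V<n$, then $\gamma$ is isomorphic to one of the two irreducible components of $\rho$; that is, there is a symmetric $n\times n$ matrix $\mathcal{E}=(\varepsilon_{i,j})$ with zero diagonal and off-diagonal coefficients in $\{-1,+1\}$ satisfying $\varepsilon_{\sigma(i),\sigma(j)}=\nu^\sigma_i\nu^\sigma_j\varepsilon_{i,j}$ for all $\sigma\in G$, $i,j\in X$, which has exactly two eigenvalues, whose two eigenspaces $E_1,E_2\subset E$ (for the endomorphism with matrix $\mathcal{E}$ in the basis $(e_1,\dots,e_n)$) are irreducible $G$-submodules of $E$, and $\gamma$ is isomorphic to the representation induced by $\rho$ on $E_1$ or to the one induced on $E_2$.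
   Context: $\Pi^n=\{\nu=(\nu_1,\dots,\nu_n): \nu_j=\pm1 \text{ for all } j\}$ is a group under componentwise multiplication. For $\nu\in\Pi^n$ and a permutation $\sigma$ of $X$, put $\nu_\sigma=(\nu_{\sigma(1)},\dots,\nu_{\sigma(n)})$. The group $G$ acts on $\Pi^n$ by automorphisms $\theta_\sigma(\nu)=\nu_{\sigma^{-1}}$, and $G\ltimes\Pi^n$ is the corresponding semidirect product, whose elements are written $(\sigma,\nu)$ with multiplication $(\sigma,\nu)(\delta,\mu)=(\sigma\delta,\ \nu_\delta\,\mu)$. Doubly transitive representation: a linear representation $\gamma$ of a permutation group $G$ on $X=\{1,\dots,n\}$ in a real vector space $V$ is called doubly transitive if there are nonzero vectors $v_1,\dots,v_n\in V$ such that (1) $v_1,\dots,v_n$ span $V$, and (2) $\langle\gamma_\sigma(v_i)\rangle=\langle v_{\sigma(i)}\rangle$ for all $i\in X$, $\sigma\in G$, where $\langle v\rangle$ denotes the line spanned by $v$. (The definition does not require the lines $\langle v_i\rangle$ to be pairwise distinct.) *)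

(* Defs.v *)
From HB Require Import structures.
From mathcomp Require Import all_boot all_order all_algebra all_fingroup.
From mathcomp Require Import all_solvable all_character.
From mathcomp Require Import sesquilinear reals.

Set Implicit Arguments.
Unset Strict Implicit.
Unset Printing Implicit Defensive.

Import Order.TTheory GRing.Theory Num.Theory.
Local Open Scope ring_scope.

(* MathComp multiplies permutations from left to right, (s * t) i = t (s i),
   whereas products in a permutation group of X are here composites of maps,
   (s o t)(i) = s (t i). *)
Definition pcomp n (s t : 'S_n) : 'S_n := (t * s)%g.

Lemma pcompE n (s t : 'S_n) i : pcomp s t i = s (t i).
Proof. exact: permM. Qed.

(* The group Pi^n of sign vectors: the boolean b stands for the sign (-1) ^+ b,
   so that addb is the product of signs. *)
Definition signs n := {ffun 'I_n -> bool}.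

Definition mul_signs n (nu mu : signs n) : signs n :=
  [ffun j => nu j (+) mu j].

Definition perm_signs n (nu : signs n) (s : 'S_n) : signs n :=
  [ffun j => nu (s j)].

(* Sym(X) |x Pi^n, with (s, nu) (t, mu) = (s o t, nu_t mu); it contains G |x Pi^n
   as the subgroup `semidirect G` below. *)
Definition signed_perm n : Type := 'S_n * signs n.

HB.instance Definition _ n := Finite.on (signed_perm n).

Section SignedPermGroup.
Variable n : nat.
Implicit Types x y z : signed_perm n.

Definition sp_mul x y : signed_perm n :=
  (pcomp x.1 y.1, mul_signs (perm_signs x.2 y.1) y.2).
Definition sp_one : signed_perm n := (1%g, [ffun=> false]).
Definition sp_inv x : signed_perm n := (x.1^-1%g, perm_signs x.2 x.1^-1%g).

Lemma sp_mulA : associative sp_mul.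
Proof.
move=> [s a] [t b] [u c]; congr (_, _); first by rewrite /pcomp /= mulgA.
by apply/ffunP => j; rewrite !ffunE /= pcompE addbA.
Qed.

Lemma sp_mul1 : left_id sp_one sp_mul.
Proof.
move=> [s a]; congr (_, _); first by rewrite /pcomp /= mulg1.
by apply/ffunP => j; rewrite !ffunE.
Qed.

Lemma sp_mulV : left_inverse sp_one sp_inv sp_mul.
Proof.
move=> [s a]; congr (_, _); first by rewrite /pcomp /= mulgV.
by apply/ffunP => j; rewrite !ffunE /= permK addbb.
Qed.

HB.instance Definition _ :=
  Finite_isGroup.Build (signed_perm n) sp_mulA sp_mul1 sp_mulV.

Lemma sp_mulE x y : (x * y)%g = sp_mul x y. Proof. by []. Qed.

Definition semidirect (G : {group 'S_n}) : {set signed_perm n} :=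
  [set x | x.1 \in G].

Lemma semidirect_group_set G : group_set (semidirect G).
Proof.
apply/group_setP; split=> [|x y]; first by rewrite inE group1.
by rewrite !inE => Gx Gy; apply: groupM.
Qed.

Canonical semidirect_group G := Group (semidirect_group_set G).

End SignedPermGroup.

(* Homomorphisms J : G -> G |x Pi^n of the form J(s) = (s, nu^s) *)
Record semidirect_hom n (G : {group 'S_n}) := SemidirectHom {
  sdhom :> 'S_n -> signed_perm n;
  sdhom_in : {in G, forall s, sdhom s \in semidirect G};
  sdhomM : {in G &, forall s t, sdhom (pcomp s t) = (sdhom s * sdhom t)%g};
  sdhom1 : {in G, forall s, (sdhom s).1 = s}
}.

Section AssociatedRepresentation.
Variables (R : realType) (n : nat) (G : {group 'S_n}) (J : semidirect_hom G).

(* The real number nu^s_j, equal to 1 or -1 *)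
Definition sdsign (s : 'S_n) (j : 'I_n) : R := (-1) ^+ (J s).2 j.

(* E is 'rV[R]_n with its standard basis e_j = delta_mx 0 j, and matrices act
   on row vectors from the right: row j below is the image of e_j. *)
Definition assoc_mx (s : 'S_n) : 'M[R]_n :=
  \matrix_(j < n) (sdsign s j *: delta_mx 0 (s j)).

Lemma assoc_mxE s j :
  delta_mx 0 j *m assoc_mx s = sdsign s j *: (delta_mx 0 (s j) : 'rV_n).
Proof. by rewrite -rowE rowK. Qed.

(* s |-> (v |-> v *m assoc_mx s) is multiplicative for the composition of
   permutations and of operators. *)
Lemma assoc_mx_repr : mx_repr G assoc_mx.
Proof.
split=> [|s t Gs Gt].
  have J11 : J 1%g = 1%g.
    have := sdhomM J (group1 G) (group1 G); rewrite /pcomp mulg1 => J1.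
    by apply: (mulgI (J 1%g)); rewrite -J1 mulg1.
  apply/row_matrixP => j.
  by rewrite rowK /sdsign J11 /= ffunE expr0 scale1r perm1 rowE mulmx1.
apply/row_matrixP => j; rewrite row_mul !rowK -scalemxAl assoc_mxE scalerA.
rewrite permM; congr (_ *: _).
have := sdhomM J Gt Gs; rewrite /pcomp /sdsign => ->.
by rewrite sp_mulE /= !ffunE (sdhom1 J Gs) signr_addb mulrC.
Qed.

Definition assoc_repr : mx_representation R G n := MxRepresentation assoc_mx_repr.

End AssociatedRepresentation.

(* Linear representation of the permutation group G on an abstract space V;
   the axioms force g s to be invertible for s in G. *)
Definition linear_repr (R : realType) n (G : {group 'S_n}) (V : vectType R)
    (g : 'S_n -> 'End(V)) : Prop :=
  g 1%g = \1%VF /\ {in G &, forall s t, g (pcomp s t) = (g s \o g t)%VF}.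

Definition doubly_transitive (R : realType) n (G : {group 'S_n})
    (V : vectType R) (g : 'S_n -> 'End(V)) : Prop :=
  exists v : 'I_n -> V,
    [/\ forall i, v i != 0,
        <<codom v>>%VS = fullv
      & {in G, forall s i, <[g s (v i)]>%VS = <[v (s i)]>%VS}].

(* The operator of rho s on 'rV_m is u |-> u *m rho s. *)
Definition repr_iso (R : realType) n (G : {group 'S_n}) (V : vectType R)
    (g : 'S_n -> 'End(V)) m (rho : mx_representation R G m) : Prop :=
  exists2 f : 'Hom(V, 'rV[R]_m), bijective f
    & {in G, forall s x, f (g s x) = f x *m rho s}.

(* Main.v *)
(* Averaging an inner product over G makes gamma orthogonal, so the v_i can be
   rescaled to unit vectors w_i that G permutes up to signs; these signs are J.
   Then x |-> (<x, w_i>)_i is an injective G-map from V to E whose image is the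
   row space of the Gram matrix M of the w_i.  By 2-transitivity M = I + c eps
   with eps a matrix of signs, and every matrix commuting with rho is of the
   form x I + y eps.  Hence eps^2 = y eps + x I with x > 0, so eps has two real
   eigenvalues.  An invariant projection onto a submodule of an eigenspace acts
   there as a scalar, so the eigenspaces are simple.  If dim V < n, then M is
   singular, so that c != 0, -1/c is one eigenvalue of eps and the image of V is
   the eigenspace of the other one. *)
Require Import Defs.
From HB Require Import structures.
From mathcomp Require Import all_boot all_order all_algebra all_fingroup.
From mathcomp Require Import all_solvable all_character.
From mathcomp Require Import sesquilinear reals.
From mathcomp Require Import ring lra.

Import Order.TTheory GRing.Theory Num.Theory.
Local Open Scope ring_scope.

Lemma two_transitive_perm {n : nat} {G : {group 'S_n}}
    (G_2trans : [transitive^2 G, on [set: 'I_n] | 'P]) (i j k l : 'I_n) :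
  i != j -> k != l -> exists2 s : 'S_n, s \in G & s i = k /\ s j = l.
Proof.
have mem2 (x y : 'I_n) : x != y -> [tuple x; y] \in dtuple_on 2 [set: 'I_n].
  by move=> xy; rewrite !inE /= !inE xy; apply/subsetP => z _; rewrite inE.
move=> /mem2 ij /mem2 kl; have [s Gs def_kl] := atransP2 G_2trans ij kl.
exists s => //; have /= /(congr1 val) /= [-> ->] := def_kl.
by rewrite /= !apermE.
Qed.

(** Lets [a] and [b] exchange roles in the quadratic relation, so that results proved for the
    eigenvalue [a] also serve [b]. *)
Lemma mulmx_sub_scalarC {R : comNzRingType} {n : nat} (A : 'M[R]_n) (a b : R) :
  (A - a%:M) *m (A - b%:M) = (A - b%:M) *m (A - a%:M).
Proof.
rewrite !mulmxBl !mulmxBr !mul_mx_scalar !mul_scalar_mx !scale_scalar_mx.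
rewrite [b * a]mulrC !opprB addrACA [RHS]addrACA.
by congr (_ + _); apply: addrC.
Qed.

(** * The commutant of the signed permutation representation *)

Definition sign_equivariant {R : realType} {n : nat} {G : {group 'S_n}}
    (J : semidirect_hom G) (T : 'M[R]_n) : Prop :=
  {in G, forall (s : 'S_n) i j,
     T (s i) (s j) = sdsign R J s i * sdsign R J s j * T i j}.

Section SignEquivariantMatrices.
Context {R : realType} {n : nat} {G : {group 'S_n}} {J : semidirect_hom G}.
Local Notation rho := (assoc_repr R J).

Lemma sdsign_mulK (s : 'S_n) i : sdsign R J s i * sdsign R J s i = 1.
Proof. by rewrite -expr2 sqrr_sign. Qed.

Lemma assoc_reprE (s : 'S_n) i k :
  rho s i k = sdsign R J s i * (k == s i)%:R.
Proof. by rewrite !mxE eqxx. Qed.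

Lemma mulmx_assoc_repr m (A : 'M[R]_(m, n)) (s : 'S_n) i j :
  (A *m rho s) i (s j) = A i j * sdsign R J s j.
Proof.
rewrite mxE (bigD1 j) //= big1 ?addr0 => [|k kj]; rewrite assoc_reprE.
  by rewrite eqxx mulr1.
by rewrite (inj_eq perm_inj) eq_sym (negbTE kj) !mulr0.
Qed.

Lemma assoc_repr_mulmx m (A : 'M[R]_(n, m)) (s : 'S_n) i j :
  (rho s *m A) i j = sdsign R J s i * A (s i) j.
Proof.
rewrite mxE (bigD1 (s i)) //= big1 ?addr0 => [|k kj]; rewrite assoc_reprE.
  by rewrite eqxx mulr1.
by rewrite (negbTE kj) mulr0 mul0r.
Qed.

(** Multiplication by [rho s] permutes columns or rows up to signs, and each sign is its own
    inverse. The entrywise form suits 2-transitivity; the commuting form passes to products and to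
    invariant projections. *)
Lemma sign_equivariantP (T : 'M[R]_n) :
  sign_equivariant J T <-> {in G, forall s, T *m rho s = rho s *m T}.
Proof.
split=> [equivT s Gs | comT s Gs i j].
  apply/matrixP=> i k; rewrite -(permKV s k) mulmx_assoc_repr assoc_repr_mulmx.
  by rewrite equivT // !mulrA sdsign_mulK mul1r mulrC.
have /matrixP/(_ i (s j)) := comT s Gs.
rewrite mulmx_assoc_repr assoc_repr_mulmx => TE.
by rewrite -mulrA [_ * T i j]mulrC TE mulrA sdsign_mulK mul1r.
Qed.

Section Commutant.
Hypothesis G_2trans : [transitive^2 G, on [set: 'I_n] | 'P].
Variables (eps : 'M[R]_n) (i0 j0 : 'I_n).
Hypotheses (i0j0 : i0 != j0) (eps_sym : eps^T = eps).
Hypotheses (eps_diag : forall i, eps i i = 0).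
Hypotheses (eps_off : forall i j, i != j -> eps i j = -1 \/ eps i j = 1).
Hypotheses (eps_equiv : sign_equivariant J eps).

Lemma eps_sqr i j : i != j -> eps i j * eps i j = 1.
Proof. by case/eps_off => ->; rewrite ?mulrNN mulr1. Qed.

(* T i j * eps i j is constant off the diagonal, because G is transitive on
   ordered pairs of distinct points and the signs cancel. *)
Lemma sign_equivariant_span (T : 'M[R]_n) :
  sign_equivariant J T ->
  T = (T i0 i0)%:M + (T i0 j0 * eps i0 j0) *: eps.
Proof.
move=> equivT; apply/matrixP=> i j; rewrite !mxE.
have [<-|ij] := eqVneq i j.
  rewrite eps_diag mulr0 addr0 mulr1n.
  (* A second point completes [i] to a pair, so transitivity on pairs also moves [i0] to [i]. *)
  have [k ki] : exists k, k != i.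
    by have [<-|?] := eqVneq i0 i; [exists j0; rewrite eq_sym | exists i0].
  have [s Gs [<- _]] := two_transitive_perm G_2trans i0 j0 i k i0j0
      (etrans (congr1 negb (eq_sym _ _)) ki).
  by rewrite equivT // sdsign_mulK mul1r.
rewrite mulr0n add0r.
have [s Gs [<- <-]] := two_transitive_perm G_2trans i0 j0 i j i0j0 ij.
rewrite equivT // eps_equiv //.
transitivity (sdsign R J s i0 * sdsign R J s j0 * T i0 j0
    * (eps i0 j0 * eps i0 j0)); first by rewrite eps_sqr // mulr1.
ring.
Qed.

Lemma eps_quadratic : exists a b : R,
  a != b /\ (eps - a%:M) *m (eps - b%:M) = 0.
Proof.
have equivE2 : sign_equivariant J (eps *m eps).
  apply/sign_equivariantP => s Gs; have /sign_equivariantP comE := eps_equiv.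
  by rewrite -mulmxA comE // mulmxA comE // mulmxA.
have E2 := sign_equivariant_span _ equivE2.
set x := (eps *m eps) i0 i0 in E2; set y := (_ * _) in E2.
(* By symmetry of [eps], [x] is the sum of the squares of row [i0], and the entry at [j0]
   contributes 1. *)
have x_gt0 : 0 < x.
  rewrite /x mxE (bigD1 j0) //=; apply: ltr_wpDr.
    apply: sumr_ge0 => k _.
    by rewrite -{2}eps_sym mxE -expr2 sqr_ge0.
  by rewrite -{2}eps_sym mxE eps_sqr.
(* The eigenvalues will be the roots of [t ^+ 2 - y * t - x], whose discriminant is positive because
   [x] is. *)
pose d := Num.sqrt (y ^+ 2 + 4 * x).
have disc : 0 < y ^+ 2 + 4 * x by have := sqr_ge0 y; lra.
have d_gt0 : 0 < d by rewrite sqrtr_gt0.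
have d2 : d ^+ 2 = y ^+ 2 + 4 * x by rewrite sqr_sqrtr // ltW.
exists ((y + d) / 2), ((y - d) / 2); split.
  by apply/eqP; lra.
rewrite mulmxBl !mulmxBr E2 mul_mx_scalar !mul_scalar_mx scale_scalar_mx.
rewrite opprB addrA.
have -> : (y + d) / 2 * ((y - d) / 2) = - x.
  have -> : (y + d) / 2 * ((y - d) / 2) = (y ^+ 2 - d ^+ 2) / 4 by field.
  by rewrite d2; field.
have -> : y = (y - d) / 2 + (y + d) / 2 by field.
apply/matrixP=> i j; rewrite !mxE.
by case: (i == j); rewrite ?mulr1n ?mulr0n; field.
Qed.

(** * Eigenvalues and eigenspaces of the sign matrix *)

Section Eigenspaces.
Variables a b : R.
Hypothesis (epsP : (eps - a%:M) *m (eps - b%:M) = 0).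

Lemma eps_neq_scalar c : eps != c%:M.
Proof.
apply/eqP=> /matrixP/(_ i0 j0); rewrite mxE (negbTE i0j0) mulr0n => e0.
have := @eps_sqr i0 j0 i0j0.
by rewrite e0 mul0r => /esym/eqP; rewrite oner_eq0.
Qed.

(** If [eps - a%:M] were invertible, cancelling it in [epsP] would make [eps] the scalar [b]. *)
Lemma eps_eigenspace_neq0 : eigenspace eps a != 0.
Proof.
rewrite kermx_eq0 row_free_unit; apply/negP => uE.
have := eps_neq_scalar b; rewrite -subr_eq0 => /eqP; apply.
by rewrite -[LHS](mulKmx uE) epsP mulmx0.
Qed.

Lemma eps_eigenvalue c : eigenvalue eps c -> c = a \/ c = b.
Proof.
case/eigenvalueP => v vE v0.
have: (c - a) *: ((c - b) *: v) = 0.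
  have vB d : v *m (eps - d%:M) = (c - d) *: v.
    by rewrite mulmxBr vE mul_mx_scalar scalerBl.
  by rewrite -vB scalemxAl -vB -mulmxA epsP mulmx0.
move/eqP; rewrite !scaler_eq0 (negbTE v0) orbF !subr_eq0.
by case/orP => /eqP; [left | right].
Qed.

(* The projection onto a submodule along a complement lies in the commutant,
   hence acts as a scalar on the eigenspace. *)
Lemma eps_eigenspace_simple : mxsimple rho (eigenspace eps a).
Proof.
split; [|exact: eps_eigenspace_neq0|].
  apply/mxmoduleP=> s Gs; apply/eigenspaceP.
  have /sign_equivariantP comE := eps_equiv.
  by rewrite -mulmxA -comE // mulmxA (eigenspaceP (submx_refl _)) scalemxAl.
move=> U modU sUE U0.
(* Maschke's theorem applies because [R] has characteristic 0. *)
have redG : mx_completely_reducible rho 1%:M.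
  apply: mx_Maschke_pchar; rewrite /pgroup pcharf'_nat pnatr_eq0.
  by rewrite -lt0n cardG_gt0.
have [W modW defUW /mxdirect_addsP dxUW] := redG U modU (submx1 U).
pose P := proj_mx U W.
have equivP : sign_equivariant J P.
  apply/sign_equivariantP => s Gs; apply/esym.
  have := proj_mx_hom dxUW modU modW; rewrite defUW => /hom_mxP/(_ s Gs).
  by rewrite !mul1mx.
have := sign_equivariant_span _ equivP; set x := P i0 i0; set y := _ * _ => PE.
have actP m (A : 'M_(m, n)) :
    (A <= eigenspace eps a)%MS -> A *m P = (x + y * a) *: A.
  move=> /eigenspaceP AE.
  by rewrite PE mulmxDr mul_mx_scalar -scalemxAr AE scalerA scalerDl.
(* [P] fixes the nonzero space [U], which forces the scalar to be 1; hence [P] fixes the whole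
   eigenspace, which then lies in the image [U]. *)
have U1 : x + y * a = 1.
  have := actP _ _ sUE; rewrite (proj_mx_id dxUW) // => /eqP.
  rewrite -{1}[U]scale1r -subr_eq0 -scalerBl scaler_eq0 (negbTE U0) orbF.
  by rewrite subr_eq0 => /eqP/esym.
have := actP _ _ (submx_refl _); rewrite U1 scale1r => <-.
exact: proj_mx_sub.
Qed.

End Eigenspaces.

End Commutant.

End SignEquivariantMatrices.

(** * Invariant inner products and unit vectors permuted up to sign *)

Section NormalizedSystem.
Context {R : realType} {n : nat} {G : {group 'S_n}} {V : vectType R}.
Context {g : 'S_n -> 'End(V)}.

(** Linearity is asked in the first argument only; symmetry carries it to the second. *)
Definition invariant_inner_product (B : V -> V -> R) : Prop :=
  [/\ forall y, linear_for *%R (B^~ y), forall x y, B x y = B y x,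
      forall x, x != 0 -> 0 < B x x
    & {in G, forall s x y, B (g s x) (g s y) = B x y}].

Lemma inner_productZl {B} : invariant_inner_product B ->
  forall k x y, B (k *: x) y = k * B x y.
Proof.
(* The instance with factor -1 at zero vectors gives [B 0 y = 0]. *)
case=> Blin _ _ _ k x y; have := Blin y k x 0; have := Blin y (-1) 0 0.
by rewrite scaler0 !addr0 mulN1r addNr => -> ->; rewrite addr0.
Qed.

Lemma inner_productZr {B} : invariant_inner_product B ->
  forall k x y, B x (k *: y) = k * B x y.
Proof.
by move=> B_inner k x y; case: (B_inner) => _ Bsym _ _; rewrite Bsym
  (inner_productZl B_inner) Bsym.
Qed.

Hypothesis g_repr : linear_repr G g.

Lemma linear_reprK s : s \in G -> cancel (g s) (g s^-1%g).
Proof.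
case: g_repr => g1 gM Gs x.
by rewrite -comp_lfunE -gM ?groupV // /Defs.pcomp mulgV g1 id_lfunE.
Qed.

Lemma linear_repr_neq0 s x : s \in G -> x != 0 -> g s x != 0.
Proof.
by move=> Gs; apply: contraNneq => gx0; rewrite -(linear_reprK s Gs x) gx0 linear0.
Qed.

Lemma ex_invariant_inner_product (dotV : {dot V for idfun}) :
  exists B, invariant_inner_product B.
Proof.
exists (fun x y => \sum_(s in G) dotV (g s x) (g s y)); split.
- move=> y k x z; rewrite mulr_sumr -big_split /=; apply: eq_bigr => s _.
  by rewrite linearP linearPl.
- by move=> x y; apply: eq_bigr => s _; rewrite hermC /= expr0 mul1r.
- move=> x x0; rewrite (bigD1 1%g) //=; apply: ltr_pwDl.
    by rewrite neq0_dnorm_gt0 // linear_repr_neq0.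
  apply: sumr_ge0 => s /andP[Gs _].
  by rewrite ltW // neq0_dnorm_gt0 // linear_repr_neq0.
(* The product [t * s] is the composite of [s] after [t], so this reindexing makes [g t] act first
   on both arguments. *)
move=> t Gt x y; rewrite [RHS](reindex_inj (mulgI t)) /=.
apply: eq_big => [s|s Gs]; first by rewrite groupMl.
have [_ gM] := g_repr.
by rewrite -[(t * s)%g]/(Defs.pcomp s t) gM // !comp_lfunE.
Qed.

Lemma ex_normalized_system (B : V -> V -> R) :
  invariant_inner_product B -> doubly_transitive G g ->
  exists (J : semidirect_hom G) (w : 'I_n -> V),
    [/\ <<codom w>>%VS = fullv, forall i, B (w i) (w i) = 1
      & {in G, forall s i, g s (w i) = sdsign R J s i *: w (s i)}].
Proof.
move=> B_inner [v [v0 v_span v_perm]].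
have [Blin Bsym Bpos Binv] := B_inner.
have BZl := inner_productZl B_inner.
have BZ k x : B (k *: x) (k *: x) = k ^+ 2 * B x x.
  by rewrite BZl (inner_productZr B_inner) mulrA.
pose c i := (Num.sqrt (B (v i) (v i)))^-1.
have c0 i : c i != 0 by rewrite invr_neq0 // sqrtr_eq0 -ltNge Bpos.
pose w i := c i *: v i.
have w1 i : B (w i) (w i) = 1.
  rewrite BZ exprVn sqr_sqrtr ?ltW ?Bpos // mulVf //.
  by rewrite gt_eqF ?Bpos.
have v_w i : v i = (c i)^-1 *: w i by rewrite scalerK.
have w_line s i : s \in G -> exists r, g s (w i) = r *: w (s i).
  move=> Gs; have : g s (v i) \in <[v (s i)]>%VS.
    by rewrite -v_perm // memv_line.
  case/vlineP => k gv; exists (c i * k / c (s i)).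
  by rewrite linearZ /= gv !scalerA divfK.
clearbody w.
(* Invariance of [B] makes the factor on the line square to 1, and the sign of the inner product
   tells which root it is. This gives an explicit formula for the signs of [J]. *)
have w_perm s i : s \in G ->
    g s (w i) = (-1) ^+ (B (g s (w i)) (w (s i)) < 0)%R *: w (s i).
  move=> Gs; have [r gw] := w_line s i Gs.
  have := Binv s Gs (w i) (w i); rewrite gw BZ BZl !w1 !mulr1 => /eqP.
  rewrite sqrf_eq1 => /orP[] /eqP ->; first by rewrite ltr10 expr0.
  by rewrite ltrN10 expr1.
pose Jf s : signed_perm n := (s, [ffun i => (B (g s (w i)) (w (s i)) < 0)%R]).
(* Pairing the image of [w i] under [g s \o g t] with [w (s (t i))] yields the product of the two
   successive signs. *)
have JfM : {in G &, forall s t, Jf (Defs.pcomp s t) = (Jf s * Jf t)%g}.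
  move=> s t Gs Gt; congr (_, _); apply/ffunP=> i; rewrite !ffunE /=.
  have [_ gM] := g_repr; rewrite gM // comp_lfunE [g t _]w_perm // linearZ /=.
  rewrite BZl [g s _]w_perm // BZl pcompE w1 mulr1 -signr_addb signr_lt0.
  by rewrite -!w_perm // addbC.
have Jf_in : {in G, forall s, Jf s \in semidirect G}.
  by move=> s Gs; rewrite inE.
have Jf1 : {in G, forall s, (Jf s).1 = s} by [].
exists (SemidirectHom Jf_in JfM Jf1), w; split=> //; last first.
  by move=> s Gs i; rewrite w_perm // /sdsign /= ffunE.
apply/eqP; rewrite eqEsubv subvf -v_span; apply/span_subvP => _ /codomP[i ->].
rewrite v_w rpredZ // memv_span //.
exact: codom_f.
Qed.

End NormalizedSystem.

Lemma lfun_bijective {K : fieldType} {aT rT : vectType K} (f : 'Hom(aT, rT)) :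
  lker f == 0%VS -> (forall y, exists x, f x = y) -> bijective f.
Proof.
move=> f_inj f_surj; exists (f^-1)%VF => [|y]; first exact: lker0_lfunK.
by have [x <-] := f_surj y; rewrite lker0_lfunK.
Qed.

(** * The coordinate map into [E] and the Gram matrix *)

Section CoordinateMap.
Context {R : realType} {n : nat} {G : {group 'S_n}} {V : vectType R}.
Context {g : 'S_n -> 'End(V)} {B : V -> V -> R}.
Context {J : semidirect_hom G} {w : 'I_n -> V}.
Hypothesis B_inner : invariant_inner_product (G := G) (g := g) B.
Hypothesis w_span : <<codom w>>%VS = fullv.
Hypothesis w_perm :
  {in G, forall s i, g s (w i) = sdsign R J s i *: w (s i)}.
Local Notation rho := (assoc_repr R J).

Definition coord_fun (x : V) : 'rV[R]_n := \row_i B x (w i).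

Lemma coord_fun_linear : linear coord_fun.
Proof.
move=> k x y; apply/rowP=> i; rewrite !mxE.
by case: B_inner => /(_ (w i)) ->.
Qed.

HB.instance Definition _ :=
  GRing.isLinear.Build R V 'rV[R]_n *:%R coord_fun coord_fun_linear.

Definition coord_map : 'Hom(V, 'rV[R]_n) := linfun coord_fun.

Lemma coord_mapE x i : coord_map x 0 i = B x (w i).
Proof. by rewrite lfunE mxE. Qed.

(** A vector orthogonal to every [w i] is orthogonal to their span, hence to itself. *)
Lemma coord_map_inj : lker coord_map == 0%VS.
Proof.
have [Blin Bsym Bpos _] := B_inner.
apply/lker0P/raddf_inj => x fx0.
suffices Bx y : B x y = 0.
  by apply/eqP/negPn/negP => /Bpos; rewrite Bx ltxx.
have : y \in <<codom w>>%VS by rewrite w_span memvf.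
rewrite -{1}[codom w]/(val (codom_tuple w)) => /coord_span ->.
elim/big_rec: _ => [|i z _ Bz].
  by rewrite -(scale0r 0) (inner_productZr B_inner) mul0r.
have /codomP[j ->] : (codom_tuple w)`_i \in codom w.
  by rewrite mem_nth // size_tuple.
by rewrite Bsym Blin [B z x]Bsym Bz addr0 Bsym -coord_mapE fx0 mxE mulr0.
Qed.

Lemma coord_map_equivariant :
  {in G, forall s x, coord_map (g s x) = coord_map x *m rho s}.
Proof.
move=> s Gs x; have [Blin Bsym _ Binv] := B_inner.
apply/rowP=> j; rewrite -(permKV s j) mulmx_assoc_repr !coord_mapE.
rewrite -(Binv s Gs x) w_perm // (inner_productZr B_inner).
by rewrite mulrAC sdsign_mulK mul1r.
Qed.

Definition gram : 'M[R]_n := \matrix_(i, j) B (w i) (w j).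

(** Row [i] of [gram] is the coordinate vector of [w i]. With [coord_map_sub_gram], this identifies
    the image of [coord_map] with the row space of [gram]. *)
Lemma gram_preimage (u : 'rV_n) : coord_map (\sum_i u 0 i *: w i) = u *m gram.
Proof.
rewrite linear_sum mulmx_sum_row; apply: eq_bigr => i _; rewrite linearZ /=.
by congr (_ *: _); apply/rowP=> j; rewrite coord_mapE !mxE.
Qed.

Lemma gram_equivariant : sign_equivariant J gram.
Proof.
move=> s Gs i j; have [_ _ _ Binv] := B_inner.
rewrite !mxE -(Binv s Gs (w i)) !w_perm // (inner_productZl B_inner) (inner_productZr B_inner).
by rewrite !mulrA [_ * _ * sdsign R J s i]mulrAC sdsign_mulK mul1r
  sdsign_mulK mul1r.
Qed.

Lemma dim_limg_coord_map : \dim (limg coord_map) = \dim {:V}.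
Proof. by rewrite limg_dim_eq // (eqP coord_map_inj) capv0. Qed.

Lemma coord_map_surj_dim :
  (forall y, exists x, coord_map x = y) -> \dim {:V} = n.
Proof.
move=> f_surj; rewrite -dim_limg_coord_map.
have -> : limg coord_map = fullv.
  apply/eqP; rewrite eqEsubv subvf; apply/subvP => y _.
  by have [x <-] := f_surj y; rewrite memv_img ?memvf.
by rewrite dimvf dim_matrix mul1r.
Qed.

Lemma gram_unit_dim : gram \in unitmx -> \dim {:V} = n.
Proof.
move=> gram_unit; apply: coord_map_surj_dim => y.
by exists (\sum_i (y *m invmx gram) 0 i *: w i); rewrite gram_preimage mulmxKV.
Qed.

Lemma repr_iso_assoc : \dim {:V} = n -> repr_iso g rho.
Proof.
move=> dimV; exists coord_map; last exact: coord_map_equivariant.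
apply: lfun_bijective coord_map_inj _ => y.
have fullE : limg coord_map = fullv.
  apply/eqP; rewrite eqEdim subvf dim_limg_coord_map dimV.
  by rewrite dimvf dim_matrix mul1r /=.
have /memv_imgP[x _ ->] : y \in limg coord_map by rewrite fullE memvf.
by exists x.
Qed.

Lemma coord_map_sub_gram x : (coord_map x <= gram)%MS.
Proof.
have /coord_span-> : x \in <<codom_tuple w>>%VS by rewrite w_span memvf.
rewrite linear_sum summx_sub // => i _; rewrite linearZ scalemx_sub //=.
have /codomP[j ->] : (codom_tuple w)`_i \in codom w.
  by rewrite mem_nth // size_tuple.
suffices -> : coord_map (w j) = row j gram by apply: row_sub.
by apply/rowP=> k; rewrite coord_mapE !mxE.
Qed.

(** Only the row space of [U] matters, so that [U] can be the matrix [eigenspace eps x] rather than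
    [gram] itself. *)
Lemma repr_iso_submod (U : 'M_n) (modU : mxmodule rho U) :
  (U :=: gram)%MS -> repr_iso g (submod_repr modU).
Proof.
move=> defU; have fU x : (coord_map x <= U)%MS.
  by rewrite defU coord_map_sub_gram.
pose f := (linfun (in_submod U (m := 1)) \o coord_map)%VF.
have fE x : f x = in_submod U (coord_map x) by rewrite comp_lfunE lfunE.
exists f; last first.
  by move=> s Gs x; rewrite !fE coord_map_equivariant // in_submodJ.
apply: lfun_bijective => [|y].
  apply/lker0P => x y; rewrite !fE => /(congr1 val_submod).
  by rewrite !in_submodK //; apply/lker0P/coord_map_inj.
have := val_submodP y; rewrite defU => /submxP[u uE].
exists (\sum_i u 0 i *: w i).
by rewrite fE gram_preimage -uE val_submodK.
Qed.

End CoordinateMap.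

(** * From the singular Gram matrix to the sign matrix *)

Theorem mainTheorem2 (R : realType) (n : nat) (n_ge2 : (2 <= n)%N)
    (G : {group 'S_n}) (G_2trans : [transitive^2 G, on [set: 'I_n] | 'P])
    (V : vectType R) (dotV : {dot V for idfun})
    (g : 'S_n -> 'End(V)) (g_repr : linear_repr G g)
    (g_dtrans : doubly_transitive G g) :
  exists J : semidirect_hom G,
    let rho := assoc_repr R J in
    (\dim {:V} = n -> repr_iso g rho) /\
    ((\dim {:V} < n)%N ->
     exists eps : 'M[R]_n,
       [/\ eps^T = eps,
           forall i, eps i i = 0,
           forall i j, i != j -> eps i j = -1 \/ eps i j = 1,
           {in G, forall (s : 'S_n) i j,
              eps (s i) (s j) = sdsign R J s i * sdsign R J s j * eps i j}
         & exists a b : R,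
             [/\ a != b,
                 forall c, eigenvalue eps c <-> c = a \/ c = b
               & exists (simE1 : mxsimple rho (eigenspace eps a))
                        (simE2 : mxsimple rho (eigenspace eps b)),
                   repr_iso g (submod_repr (mxsimple_module simE1)) \/
                   repr_iso g (submod_repr (mxsimple_module simE2))]]).
Proof.
have [B B_inner] := ex_invariant_inner_product g_repr dotV.
have [J [w [w_span w_unit w_perm]]] :=
  ex_normalized_system g_repr _ B_inner g_dtrans.
exists J => rho; split=> [|ltdimV].
  exact: repr_iso_assoc B_inner w_span w_perm.
pose M := gram (B := B) (w := w).
have M_equiv : sign_equivariant J M := gram_equivariant B_inner w_perm.
have M_sym i j : M i j = M j i by rewrite !mxE; case: B_inner.
have M_diag i : M i i = 1 by rewrite mxE w_unit.
have M_sing : M \notin unitmx.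
  apply/negP => /(gram_unit_dim B_inner w_span) dimV.
  by rewrite dimV ltnn in ltdimV.
pose i0 := Ordinal (ltnW n_ge2); pose j0 := Ordinal n_ge2.
have i0j0 : i0 != j0 by [].
pose c := M i0 j0.
have M_off i j : i != j -> M i j = c \/ M i j = - c.
  move=> ij; have [s Gs [<- <-]] := two_transitive_perm G_2trans i0 j0 i j i0j0 ij.
  rewrite M_equiv // /sdsign -signr_addb -/c.
  by case: (_ (+) _); rewrite ?expr0 ?mul1r ?expr1 ?mulN1r; [right | left].
have c0 : c != 0.
  apply: contraNneq M_sing => c0; suffices -> : M = 1%:M by apply: unitmx1.
  apply/matrixP=> i j; rewrite [RHS]mxE; have [<-|ij] := eqVneq i j.
    by rewrite M_diag.
  by have [->|->] := M_off i j ij; rewrite c0 ?oppr0.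
pose eps := c^-1 *: (M - 1%:M).
have epsE i j : eps i j = c^-1 * (M i j - (i == j)%:R).
  by rewrite [in LHS]mxE [X in _ * X]mxE [X in _ + X]mxE [in X in _ + X]mxE.
have eps_sym : eps^T = eps.
  by apply/matrixP=> i j; rewrite mxE !epsE M_sym eq_sym.
have eps_diag i : eps i i = 0 by rewrite epsE M_diag eqxx subrr mulr0.
have eps_off i j : i != j -> eps i j = -1 \/ eps i j = 1.
  move=> ij; rewrite epsE (negbTE ij) subr0.
  by have [->|->] := M_off i j ij; rewrite ?mulrN mulVf //; [right | left].
have eps_equiv : sign_equivariant J eps.
  move=> s Gs i j; rewrite !epsE (inj_eq perm_inj) M_equiv //.
  rewrite [RHS]mulrCA; congr (_ * _); rewrite mulrBr; congr (_ - _).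
  by have [->|] := eqVneq i j; rewrite ?mulr0 // mulr1 sdsign_mulK.
have [a [b [ab epsP]]] :=
  eps_quadratic G_2trans eps i0 j0 i0j0 eps_sym eps_diag eps_off eps_equiv.
have epsP' : (eps - b%:M) *m (eps - a%:M) = 0.
  by rewrite mulmx_sub_scalarC.
have eigP x : eigenvalue eps x <-> x = a \/ x = b.
  split=> [|[] ->]; first exact: eps_eigenvalue eps a b epsP x.
    exact: eps_eigenspace_neq0 eps i0 j0 i0j0 eps_off a b epsP.
  exact: eps_eigenspace_neq0 eps i0 j0 i0j0 eps_off b a epsP'.
exists eps; split=> //; exists a, b; split=> //.
have simE := eps_eigenspace_simple G_2trans eps i0 j0 i0j0 eps_diag eps_off eps_equiv.
have M_eps : M = c *: (eps - (- c^-1)%:M).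
  rewrite /eps raddfN opprK scalerDr scalerA mulfV // scale1r.
  by rewrite scale_scalar_mx mulfV // subrK.
(* When [y] is [- c^-1], [M] is a multiple of the second factor, so its rows lie in the eigenspace
   of [x]; that eigenspace is simple and [M] is a nonzero submodule, so they coincide. *)
have eigM x y (epsxy : (eps - x%:M) *m (eps - y%:M) = 0) :
    y = - c^-1 -> (eigenspace eps x :=: M)%MS.
  move=> yE; have [_ _ minE] := simE x y epsxy.
  have sME : (M <= eigenspace eps x)%MS.
    by rewrite M_eps -yE; apply/sub_kermxP; rewrite -scalemxAl mulmx_sub_scalarC epsxy scaler0.
  apply/eqmxP; rewrite sME andbT; apply: minE => //.
    apply/mxmoduleP => s Gs; have /sign_equivariantP -> // := M_equiv.
    exact: submxMl.
  apply/eqP=> /matrixP/(_ i0 i0)/eqP; rewrite M_diag mxE.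
  by rewrite oner_eq0.
exists (simE a b epsP), (simE b a epsP').
have : eigenvalue eps (- c^-1).
  rewrite /eigenvalue kermx_eq0 row_free_unit; apply: contra M_sing => uE.
  by rewrite M_eps unitmxZ ?unitfE.
(* If [- c^-1] is [a], the image of [V] is the eigenspace of [b], and conversely; hence the crossed
   choice of sides. *)
case/eigP => /esym cE; [right | left];
  apply: (repr_iso_submod B_inner w_span w_perm).
  exact: eigM epsP' cE.
exact: eigM epsP cE.
Qed.
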